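(* Let $K$ be a field and let $\Lambda=K\mathcal Q/I$ be the Brauer configuration algebra associated to a Brauer configuration $\Gamma$. Then $I$ is an admissible ideal of $K\mathcal Q$ and $\Lambda$ is a symmetric algebra.
   Context: Let $J$ be the two-sided ideal of $K\mathcal Q$ generated by the arrows; $I$ is admissible if $J^N\subseteq I\subseteq J^2$ for some $N\ge2$. Brauer configuration. A Brauer configuration $\Gamma=(\Gamma_0,\Gamma_1,\mu,\mathfrak o)$ consists of a finite set $\Gamma_0$ of vertices, a finite collection $\Gamma_1$ of labelled finite multisets of elements of $\Gamma_0$, called polygons (differently labelled polygons may be equal as multisets; a $d$-gon is a polygon with $d$ elements counted with multiplicity), a multiplicity function $\mu\colon\Gamma_0\to\mathbb Z_{>0}$, and an orientation $\mathfrak o$. For $\alpha\in\Gamma_0$, $V\in\Gamma_1$, $\mathrm{occ}(\alpha,V)$ is the number of times $\alpha$ occurs in $V$, and $\mathrm{val}(\alpha)=\sum_{V\in\Gamma_1}\mathrm{occ}(\alpha,V)$. An orientation is a choice, for each $\alpha\in\Gamma_0$, of a cyclic ordering of the list of polygons containing $\alpha$, where each $V$ is listed $\mathrm{occ}(\alpha,V)$ times (the different occurrences being distinguished). It is required that: every vertex lies in at least one polygon; every polygon has at least two vertices (counted with multiplicity); every polygon contains a vertex $\alpha$ with $\mathrm{val}(\alpha)\mu(\alpha)>1$. A vertex $\alpha$ is truncated if $\mathrm{val}(\alpha)\mu(\alpha)=1$, and nontruncated otherwise. Quiver. $\mathcal Q=\mathcal Q_\Gamma$ has one vertex $v$ for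 each polygon $V\in\Gamma_1$. For a nontruncated $\alpha$, the cyclically ordered list $V_1<\dots<V_t$ ($t=\mathrm{val}(\alpha)$, $V_{t+1}=V_1$) given by $\mathfrak o$ is the successor sequence at $\alpha$; for each $r=1,\dots,t$ there is an arrow $a_r$ from the vertex $v_r$ associated to $V_r$ to the vertex $v_{r+1}$ associated to $V_{r+1}$ (a loop if $t=1$). The arrows obtained for different $\alpha$ and different $r$ are distinct, and these are all arrows of $\mathcal Q$. Paths are written from left to right. Special cycles. With this notation put $C_j=a_ja_{j+1}\cdots a_ta_1\cdots a_{j-1}$. If $V$ is a polygon containing $\alpha$, the special $\alpha$-cycles at $v$ are the $C_j$ with $V_j=V$ (so there are $\mathrm{occ}(\alpha,V)$ of them). Algebra. $\Lambda=K\mathcal Q/I$, where $I$ is generated by: (type one) all $C^{\mu(\alpha)}-(C')^{\mu(\beta)}$ where, for some polygon $V$, $C$ is a special $\alpha$-cycle at $v$ and $C'$ is a special $\beta$-cycle at $v$, with $\alpha,\beta$ nontruncated vertices of $V$ (possibly $\alpha=\beta$); (type two) all $C^{\mu(\alpha)}a$ where $C$ is a special $\alpha$-cycle and $a$ is the first arrow of $C$; (type three) all paths $ab$ of length two that are not a subpath of any special cycle, except those with $a=b$ a loop associated to a vertex $\alpha$ with $\mathrm{val}(\alpha)=1$ and $\mu(\alpha)>1$. *)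

(* Defs.v *)
From HB Require Import structures.
From mathcomp Require Import all_boot all_algebra perm.
From mathcomp Require Import generic_quotient ring_quotient.
From mathcomp Require Import finmap multiset monalg boolp classical_sets.

Set Implicit Arguments.
Unset Strict Implicit.
Unset Printing Implicit Defensive.

Import GRing.Theory.

Local Open Scope classical_set_scope.
Local Open Scope quotient_scope.
Local Open Scope ring_scope.

(* Unital associative K-algebras. MathComp's algType K excludes the zero ring,
   which does occur here, as the path algebra of the empty quiver. The product
   is a field of the mixin because Hierarchy Builder accepts no structure with
   the parents PzRing and Lmodule besides lalgType; the ring structure is
   derived right below. *)
HB.mixin Record Lmodule_isKAlgebra (K : fieldType) A of GRing.Lmodule K A := {
  kone : A;
  kmul : A -> A -> A;
  kmulA : associative kmul;
  kmul1 : left_id kone kmul;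
  kmulr1 : right_id kone kmul;
  kmulDl : left_distributive kmul +%R;
  kmulDr : right_distributive kmul +%R;
  kscaleAl : forall (c : K) (x y : A), c *: kmul x y = kmul (c *: x) y;
  kscaleAr : forall (c : K) (x y : A), c *: kmul x y = kmul x (c *: y)
}.

#[short(type="kAlgType")]
HB.structure Definition KAlgebra (K : fieldType) :=
  {A of Lmodule_isKAlgebra K A & GRing.Lmodule K A}.

HB.instance Definition _ (K : fieldType) (A : kAlgType K) :=
  GRing.Zmodule_isPzRing.Build (KAlgebra.sort A)
    kmulA kmul1 kmulr1 kmulDl kmulDr.

Section KAlgebraTheory.
Variables (K : fieldType) (A : kAlgType K).

Lemma kscalerAl (c : K) (x y : A) : c *: (x * y) = (c *: x) * y.
Proof. exact: kscaleAl. Qed.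

Lemma kscalerAr (c : K) (x y : A) : c *: (x * y) = x * (c *: y).
Proof. exact: kscaleAr. Qed.

End KAlgebraTheory.

Section Ideals.
Variables (K : fieldType) (A : kAlgType K).

Definition two_sided_ideal (I : set A) : Prop :=
  [/\ I 0, forall x y, I x -> I y -> I (x + y)
    & forall a x b : A, I x -> I (a * x * b)].

Record ideal := Ideal { ideal_set :> set A; _ : two_sided_ideal ideal_set }.

Lemma idealP (I : ideal) : two_sided_ideal I. Proof. by case: I. Qed.

Lemma ideal_gen_subproof (S : set A) :
  two_sided_ideal (smallest two_sided_ideal S).
Proof.
split=> [I [[]]//|x y Ix Iy I HI|a x b Ix I HI]; have [[_ ID IM] _] := HI.
  by apply: ID; [apply: Ix|apply: Iy].
by apply: IM; apply: Ix.
Qed.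

Definition ideal_gen (S : set A) : ideal := Ideal (ideal_gen_subproof S).

Definition ideal_mul (I J : ideal) : ideal :=
  ideal_gen [set x * y | x in I & y in J].

Definition ideal_exp (I : ideal) (n : nat) : ideal :=
  iter n (ideal_mul I) (ideal_gen setT).

End Ideals.

(* The quotient type needs a boolean predicate, whence the classical `[< >]. *)
Section QuotientAlgebra.
Variables (K : fieldType) (A : kAlgType K) (I : ideal A).

Definition ideal_mem : {pred A} := fun x => `[< ideal_set I x >].

Fact ideal_mem_zmod_closed : zmod_closed ideal_mem.
Proof.
have [I0 ID IM] := idealP I.
split; first exact/asboolP.
move=> x y /asboolP Ix /asboolP Iy; apply/asboolP/ID => //.
by have := IM (-1) y 1 Iy; rewrite mulr1 mulN1r.
Qed.

HB.instance Definition _ :=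
  GRing.isZmodClosed.Build A ideal_mem ideal_mem_zmod_closed.

Definition quot_alg := Quotient.quot ideal_mem.

HB.instance Definition _ := GRing.Zmodule.on quot_alg.
HB.instance Definition _ := Quotient.on quot_alg.

Definition quot_pi (x : A) : quot_alg := \pi_(Quotient.quot ideal_mem) x.

Lemma quot_piP x y : (quot_pi x = quot_pi y) <-> ideal_set I (x - y).
Proof.
have -> : ideal_set I (x - y) <-> (x - y) \in ideal_mem.
  by rewrite unfold_in; split=> /asboolP.
by rewrite Quotient.idealrBE; split=> /eqP.
Qed.

Lemma quot_piK (x : quot_alg) : quot_pi (repr x) = x.
Proof. exact: reprK. Qed.

Lemma quot_piD x y : quot_pi (x + y) = quot_pi x + quot_pi y.
Proof. exact: (@Quotient.pi_add A ideal_mem). Qed.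

Definition quot_one : quot_alg := quot_pi 1.
Definition quot_mul (x y : quot_alg) : quot_alg := quot_pi (repr x * repr y).
Definition quot_scale (c : K) (x : quot_alg) : quot_alg :=
  quot_pi (c *: repr x).

Lemma quot_reprK x : ideal_set I (repr (quot_pi x) - x).
Proof. by apply/quot_piP; rewrite quot_piK. Qed.

Lemma quot_piM x y : quot_mul (quot_pi x) (quot_pi y) = quot_pi (x * y).
Proof.
have [_ ID IM] := idealP I; apply/quot_piP.
set x' := repr _; set y' := repr _.
have -> : x' * y' - x * y = 1 * (x' - x) * y' + x * (y' - y) * 1.
  by rewrite mul1r mulr1 mulrBl mulrBr addrA subrK.
by apply: ID; apply: IM; apply: quot_reprK.
Qed.

Lemma quot_piZ c x : quot_scale c (quot_pi x) = quot_pi (c *: x).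
Proof.
have [_ _ IM] := idealP I; apply/quot_piP; rewrite -scalerBr.
have := IM (c *: (1 : A)) _ 1 (quot_reprK x).
by rewrite mulr1 -kscalerAl mul1r.
Qed.

Fact quot_mulA : associative quot_mul.
Proof.
move=> x y z; rewrite -(quot_piK x) -(quot_piK y) -(quot_piK z).
by rewrite !quot_piM mulrA.
Qed.

Fact quot_mul1 : left_id quot_one quot_mul.
Proof. by move=> x; rewrite -(quot_piK x) quot_piM mul1r. Qed.

Fact quot_mulr1 : right_id quot_one quot_mul.
Proof. by move=> x; rewrite -(quot_piK x) quot_piM mulr1. Qed.

Fact quot_mulDl : left_distributive quot_mul +%R.
Proof.
move=> x y z; rewrite -(quot_piK x) -(quot_piK y) -(quot_piK z).
by rewrite -quot_piD !quot_piM -quot_piD mulrDl.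
Qed.

Fact quot_mulDr : right_distributive quot_mul +%R.
Proof.
move=> x y z; rewrite -(quot_piK x) -(quot_piK y) -(quot_piK z).
by rewrite -quot_piD !quot_piM -quot_piD mulrDr.
Qed.

Fact quot_scaleA a b x : quot_scale a (quot_scale b x) = quot_scale (a * b) x.
Proof. by rewrite -(quot_piK x) !quot_piZ scalerA. Qed.

Fact quot_scale1 : left_id 1 quot_scale.
Proof. by move=> x; rewrite -(quot_piK x) quot_piZ scale1r. Qed.

Fact quot_scaleDr : right_distributive quot_scale +%R.
Proof.
move=> c x y; rewrite -(quot_piK x) -(quot_piK y).
by rewrite -quot_piD !quot_piZ -quot_piD scalerDr.
Qed.

Fact quot_scaleDl x : {morph quot_scale^~ x : a b / a + b}.
Proof.
by move=> a b; rewrite -(quot_piK x) !quot_piZ -quot_piD scalerDl.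
Qed.

HB.instance Definition _ := GRing.Zmodule_isLmodule.Build K quot_alg
  quot_scaleA quot_scale1 quot_scaleDr quot_scaleDl.

Fact quot_scalerAl (c : K) (x y : quot_alg) :
  c *: quot_mul x y = quot_mul (c *: x) y.
Proof.
rewrite -(quot_piK x) -(quot_piK y).
rewrite quot_piM -[LHS]/(quot_scale c _) -[c *: _]/(quot_scale c _).
by rewrite !quot_piZ quot_piM kscalerAl.
Qed.

Fact quot_scalerAr (c : K) (x y : quot_alg) :
  c *: quot_mul x y = quot_mul x (c *: y).
Proof.
rewrite -(quot_piK x) -(quot_piK y).
rewrite quot_piM -[LHS]/(quot_scale c _) -[c *: _]/(quot_scale c _).
by rewrite !quot_piZ quot_piM kscalerAr.
Qed.

HB.instance Definition _ := Lmodule_isKAlgebra.Build K quot_alg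
  quot_mulA quot_mul1 quot_mulr1 quot_mulDl quot_mulDr
  quot_scalerAl quot_scalerAr.
HB.instance Definition _ := GRing.PzRing.copy quot_alg
  (quot_alg : kAlgType K).

End QuotientAlgebra.

Definition finite_dimensional (K : fieldType) (A : lmodType K) : Prop :=
  exists n, inhabited (Vector.axiom n A).

(* A is isomorphic, as an A-A-bimodule, to D(A) = Hom_K(A, K), on which A acts
   by (a f b)(z) = f (b z a). *)
Definition symmetric_algebra (K : fieldType) (A : kAlgType K) : Prop :=
  finite_dimensional A /\
  exists theta : A -> {scalar A},
    [/\ forall c x y, theta (c *: x + y) =1 (fun z => c * theta x z + theta y z),
        forall a x b, theta (a * x * b) =1 (fun z => theta x (b * z * a)),
        forall x y, theta x =1 theta y -> x = y
      & forall f : {scalar A}, exists x, theta x =1 f].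

Record quiver := Quiver {
  qvertex : finType;
  qarrow : finType;
  qsrc : qarrow -> qvertex;
  qtgt : qarrow -> qvertex
}.

Section Paths.
Variable Q : quiver.

Fixpoint walk (v : qvertex Q) (s : seq (qarrow Q)) : bool :=
  if s is a :: s' then (qsrc a == v) && walk (qtgt a) s' else true.

(* A path is its source together with its arrows from left to right; the pair
   (v, [::]) is the trivial path at v. *)
Definition qpath := {x : qvertex Q * seq (qarrow Q) | walk x.1 x.2}.
HB.instance Definition _ := SubChoice.on qpath.

Definition psrc (p : qpath) : qvertex Q := (val p).1.
Definition parrows (p : qpath) : seq (qarrow Q) := (val p).2.
Definition ptgt (p : qpath) : qvertex Q :=
  last (psrc p) [seq qtgt a | a <- parrows p].

Definition mkpath v s (w : walk v s) : qpath :=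
  exist (fun x => walk x.1 x.2) (v, s) w.

Definition trivial_path (v : qvertex Q) : qpath := @mkpath v [::] isT.

Lemma walk_arrow (a : qarrow Q) : walk (qsrc a) [:: a].
Proof. by rewrite /= eqxx. Qed.

Definition arrow_path (a : qarrow Q) : qpath :=
  mkpath (walk_arrow a).

Definition pcat (p q : qpath) : option qpath :=
  if ptgt p == psrc q then insub (psrc p, parrows p ++ parrows q) else None.

Lemma walk_cat v s1 s2 :
  walk v (s1 ++ s2) = walk v s1 && walk (last v (map (@qtgt Q) s1)) s2.
Proof. by elim: s1 v => //= a s IH v; rewrite IH andbA. Qed.

Lemma pcatP p q : ptgt p = psrc q ->
  exists2 r, pcat p q = Some r & val r = (psrc p, parrows p ++ parrows q).
Proof.
move=> E; rewrite /pcat E eqxx; case: insubP => [r _ Er|]; first by exists r.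
by rewrite /= walk_cat (valP p) -/(ptgt p) E (valP q).
Qed.

Lemma pcatN p q : ptgt p != psrc q -> pcat p q = None.
Proof. by rewrite /pcat => /negbTE->. Qed.

Lemma pcatA p q r :
  obind (pcat p) (pcat q r) = obind (fun s => pcat s r) (pcat p q).
Proof.
have [Epq|Npq] := eqVneq (ptgt p) (psrc q); last first.
  rewrite (pcatN Npq) /=.
  have [Eqr|Nqr] := eqVneq (ptgt q) (psrc r); last by rewrite pcatN.
  have [s -> Es] := pcatP Eqr.
  by rewrite /= pcatN // [psrc s]/psrc Es.
have [s -> Es] := pcatP Epq; rewrite [RHS]/=.
have ts : ptgt s = ptgt q.
  by rewrite /ptgt /psrc /parrows Es [LHS]/= map_cat last_cat -/(ptgt p) Epq.
have [Eqr|Nqr] := eqVneq (ptgt q) (psrc r); last first.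
  by rewrite [pcat q r]pcatN // pcatN ?ts.
have [u -> Eu] := pcatP Eqr; rewrite [LHS]/=.
have [|w -> Ew] := @pcatP p u; first by rewrite [psrc u]/psrc Eu.
have [|w' -> Ew'] := @pcatP s r; first by rewrite ts.
congr Some; apply: val_inj; rewrite Ew Ew' /psrc /parrows Es Eu /=.
by rewrite catA.
Qed.

Lemma pcat1p v q : pcat (trivial_path v) q = if v == psrc q then Some q else None.
Proof.
rewrite /pcat /ptgt /=; case: eqP => // ->.
have -> : (psrc q, parrows q) = val q by rewrite /psrc /parrows; case: (val q).
by rewrite valK.
Qed.

Lemma pcatp1 v q : pcat q (trivial_path v) = if ptgt q == v then Some q else None.
Proof.
rewrite /pcat /parrows /= cats0; case: eqP => // _.
have -> : (psrc q, (val q).2) = val q by rewrite /psrc; case: (val q).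
by rewrite valK.
Qed.

End Paths.

Definition path_alg (K : fieldType) (Q : quiver) := {malg K[qpath Q]}.
HB.instance Definition _ (K : fieldType) (Q : quiver) :=
  GRing.Zmodule.on (path_alg K Q).

(* This is the scaling of {malg K[qpath Q]}, locked (as are path_elt and pa_mul
   below) because conversion tends to diverge when it unfolds the operations of
   malg. *)
HB.lock Definition pa_scale (K : fieldType) (Q : quiver) (c : K)
  (f : path_alg K Q) : path_alg K Q := c *: (f : {malg K[qpath Q]}).

Section PathModule.
Variables (K : fieldType) (Q : quiver).

Fact pa_scaleA a b (f : path_alg K Q) :
  pa_scale a (pa_scale b f) = pa_scale (a * b) f.
Proof. by rewrite unlock; apply: scalerA. Qed.

Fact pa_scale1 : left_id 1 (@pa_scale K Q).
Proof. by move=> f; rewrite unlock; apply: scale1r. Qed.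

Fact pa_scaleDr : right_distributive (@pa_scale K Q) +%R.
Proof. by move=> c f g; rewrite unlock; apply: scalerDr. Qed.

Fact pa_scaleDl (f : path_alg K Q) : {morph (@pa_scale K Q)^~ f : a b / a + b}.
Proof. by move=> a b; rewrite unlock; apply: scalerDl. Qed.

HB.instance Definition _ := GRing.Zmodule_isLmodule.Build K (path_alg K Q)
  pa_scaleA pa_scale1 pa_scaleDr pa_scaleDl.

Lemma pa_scaleE c (f : path_alg K Q) :
  c *: f = c *: (f : {malg K[qpath Q]}) :> {malg K[qpath Q]}.
Proof. by rewrite -[LHS]/(pa_scale c f) unlock. Qed.

Lemma mcoeff_scale c (f : path_alg K Q) p : (c *: f)@_p = c * f@_p.
Proof. by rewrite pa_scaleE mcoeffZ. Qed.

Lemma msupp_scale c (f : path_alg K Q) : (msupp (c *: f) `<=` msupp f)%fset.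
Proof. by rewrite pa_scaleE msuppZ_le. Qed.

End PathModule.

HB.lock Definition path_elt (K : fieldType) (Q : quiver) (p : qpath Q) :
  path_alg K Q := << p >>.

Definition opath_elt (K : fieldType) (Q : quiver) (o : option (qpath Q)) :
    path_alg K Q :=
  if o is Some p then path_elt K p else 0.

HB.lock Definition pa_mul (K : fieldType) (Q : quiver) (f g : path_alg K Q) :
    path_alg K Q :=
  \sum_(p <- msupp f) \sum_(q <- msupp g)
    (f@_p * g@_q) *: opath_elt K (pcat p q).

Section PathAlgebra.
Variables (K : fieldType) (Q : quiver).

Local Notation path_alg := (path_alg K Q).
Local Notation path_elt := (@path_elt K Q).
Local Notation opath_elt := (@opath_elt K Q).
Local Notation pa_mul := (@pa_mul K Q).

Definition pa_one : path_alg :=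
  \sum_(v : qvertex Q) path_elt (trivial_path v).

Lemma pa_mulEw (d1 d2 : {fset qpath Q}) f g :
  (msupp f `<=` d1)%fset -> (msupp g `<=` d2)%fset ->
  pa_mul f g =
    \sum_(p <- d1) \sum_(q <- d2) (f@_p * g@_q) *: opath_elt (pcat p q).
Proof.
move=> s1 s2; rewrite unlock (big_fset_incl _ s1) /=; last first.
  move=> p _ pf; rewrite big1 // => q _.
  by rewrite (mcoeff_outdom pf) mul0r scale0r.
apply: eq_bigr => p _; rewrite (big_fset_incl _ s2) //= => q _ qg.
by rewrite (mcoeff_outdom qg) mulr0 scale0r.
Qed.

Fact pa_mulDl : left_distributive pa_mul +%R.
Proof.
move=> f1 f2 g; pose d := (msupp f1 `|` msupp f2)%fset.
rewrite (@pa_mulEw d (msupp g)) ?(msuppD_le, fsubset_refl) //.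
rewrite (@pa_mulEw d (msupp g) f1) ?(fsubsetUl, fsubset_refl) //.
rewrite (@pa_mulEw d (msupp g) f2) ?(fsubsetUr, fsubset_refl) //.
rewrite -big_split /=; apply: eq_bigr => p _.
rewrite -big_split /=; apply: eq_bigr => q _.
by rewrite mcoeffD mulrDl scalerDl.
Qed.

Fact pa_mulDr : right_distributive pa_mul +%R.
Proof.
move=> f g1 g2; pose d := (msupp g1 `|` msupp g2)%fset.
rewrite (@pa_mulEw (msupp f) d) ?(msuppD_le, fsubset_refl) //.
rewrite (@pa_mulEw (msupp f) d _ g1) ?(fsubsetUl, fsubset_refl) //.
rewrite (@pa_mulEw (msupp f) d _ g2) ?(fsubsetUr, fsubset_refl) //.
rewrite -big_split /=; apply: eq_bigr => p _.
rewrite -big_split /=; apply: eq_bigr => q _.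
by rewrite mcoeffD mulrDr scalerDl.
Qed.

Fact pa_scaleAl c f g : c *: pa_mul f g = pa_mul (c *: f) g.
Proof.
rewrite (@pa_mulEw (msupp f) (msupp g) f g) ?fsubset_refl //.
rewrite (@pa_mulEw (msupp f) (msupp g) (c *: f)) ?(msupp_scale, fsubset_refl) //.
rewrite scaler_sumr; apply: eq_bigr => p _.
rewrite scaler_sumr; apply: eq_bigr => q _.
by rewrite mcoeff_scale scalerA mulrA.
Qed.

Fact pa_scaleAr c f g : c *: pa_mul f g = pa_mul f (c *: g).
Proof.
rewrite (@pa_mulEw (msupp f) (msupp g) f g) ?fsubset_refl //.
rewrite (@pa_mulEw (msupp f) (msupp g) f (c *: g))
  ?(msupp_scale, fsubset_refl) //.
rewrite scaler_sumr; apply: eq_bigr => p _.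
rewrite scaler_sumr; apply: eq_bigr => q _.
by rewrite mcoeff_scale scalerA mulrCA.
Qed.

Lemma pa_mul0r f : pa_mul 0 f = 0.
Proof. by rewrite -[X in pa_mul X](scale0r 0) -pa_scaleAl scale0r. Qed.

Lemma pa_mulr0 f : pa_mul f 0 = 0.
Proof. by rewrite -[X in pa_mul _ X](scale0r 0) -pa_scaleAr scale0r. Qed.

Lemma pa_mul_suml (I : Type) (r : seq I) (F : I -> path_alg) g :
  pa_mul (\sum_(i <- r) F i) g = \sum_(i <- r) pa_mul (F i) g.
Proof.
exact: (big_morph (pa_mul^~ g) (fun x y => pa_mulDl x y g) (pa_mul0r g)).
Qed.

Lemma pa_mul_sumr (I : Type) (r : seq I) (F : I -> path_alg) g :
  pa_mul g (\sum_(i <- r) F i) = \sum_(i <- r) pa_mul g (F i).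
Proof. exact: (big_morph (pa_mul g) (pa_mulDr g) (pa_mulr0 g)). Qed.

Lemma mcoeff_path_elt p q : (path_elt p)@_q = (p == q)%:R :> K.
Proof. by rewrite unlock mcoeffU. Qed.

Lemma msupp_path_elt p : (msupp (path_elt p) `<=` [fset p])%fset.
Proof. by rewrite unlock msuppU_le. Qed.

Lemma path_eltZ (c : K) p : << c *g p >> = c *: path_elt p.
Proof.
by apply/malgP => q; rewrite mcoeff_scale mcoeff_path_elt mcoeffU mulr_natr.
Qed.

Lemma path_algE (f : path_alg) : f = \sum_(p <- msupp f) f@_p *: path_elt p.
Proof.
rewrite {1}(monalgE (f : {malg K[qpath Q]})).
by apply: eq_bigr => p _; apply: path_eltZ.
Qed.

Lemma path_alg_ind (P : path_alg -> Prop) :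
  P 0 -> (forall f g, P f -> P g -> P (f + g)) ->
  (forall c p, P (c *: path_elt p)) -> forall f, P f.
Proof. by move=> P0 PD PZ f; rewrite [f]path_algE; apply: big_ind. Qed.

Lemma pa_mulE p q : pa_mul (path_elt p) (path_elt q) = opath_elt (pcat p q).
Proof.
rewrite (pa_mulEw (msupp_path_elt p) (msupp_path_elt q)).
by rewrite !big_seq_fset1 !mcoeff_path_elt !eqxx mulr1 scale1r.
Qed.

Lemma pa_mulEo o p :
  pa_mul (opath_elt o) (path_elt p) = opath_elt (obind (fun q => pcat q p) o).
Proof. by case: o => [q|] /=; rewrite ?pa_mulE ?pa_mul0r. Qed.

Lemma pa_mulEor o p :
  pa_mul (path_elt p) (opath_elt o) = opath_elt (obind (pcat p) o).
Proof. by case: o => [q|] /=; rewrite ?pa_mulE ?pa_mulr0. Qed.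

Let congrZ (c : K) (x y : path_alg) : x = y -> c *: x = c *: y.
Proof. by move->. Qed.

Fact pa_mulA : associative pa_mul.
Proof.
move=> f g h; elim/path_alg_ind: f => [|f1 f2 E1 E2|c p].
- by rewrite !pa_mul0r.
- by rewrite (pa_mulDl f1 f2 g) (pa_mulDl f1 f2) (pa_mulDl _ _ h) E1 E2.
rewrite -(pa_scaleAl c (path_elt p) (pa_mul g h)).
rewrite -(pa_scaleAl c (path_elt p) g).
rewrite -(pa_scaleAl c (pa_mul (path_elt p) g) h).
apply: congrZ => {c}.
elim/path_alg_ind: g => [|g1 g2 E1 E2|c q].
- by rewrite pa_mulr0 !pa_mul0r pa_mulr0.
- by rewrite (pa_mulDl g1 g2) !(pa_mulDr (path_elt p)) pa_mulDl E1 E2.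
rewrite -(pa_scaleAl c (path_elt q) h).
rewrite -(pa_scaleAr c (path_elt p) (pa_mul (path_elt q) h)).
rewrite -(pa_scaleAr c (path_elt p) (path_elt q)).
rewrite -(pa_scaleAl c (pa_mul (path_elt p) (path_elt q)) h).
apply: congrZ => {c}; elim/path_alg_ind: h => [|h1 h2 E1 E2|c r].
- by rewrite !pa_mulr0.
- by rewrite !(pa_mulDr _ h1) pa_mulDr E1 E2.
rewrite -(pa_scaleAr c (path_elt q) (path_elt r)).
rewrite -(pa_scaleAr c (path_elt p) (pa_mul (path_elt q) (path_elt r))).
rewrite -(pa_scaleAr c (pa_mul (path_elt p) (path_elt q)) (path_elt r)).
by apply: congrZ; rewrite !pa_mulE pa_mulEo pa_mulEor pcatA.
Qed.

Fact pa_mul1 : left_id pa_one pa_mul.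
Proof.
elim/path_alg_ind => [|f1 f2 E1 E2|c p]; first by rewrite pa_mulr0.
  by rewrite pa_mulDr E1 E2.
rewrite -(pa_scaleAr c _ (path_elt p)); apply: congrZ.
rewrite pa_mul_suml (bigD1 (psrc p)) //= pa_mulE pcat1p eqxx.
rewrite big1 ?addr0 // => v vp.
by rewrite pa_mulE pcat1p (negbTE vp).
Qed.

Fact pa_mulr1 : right_id pa_one pa_mul.
Proof.
elim/path_alg_ind => [|f1 f2 E1 E2|c p]; first by rewrite pa_mul0r.
  by rewrite pa_mulDl E1 E2.
rewrite -(pa_scaleAl c (path_elt p)); apply: congrZ.
rewrite pa_mul_sumr (bigD1 (ptgt p)) //= pa_mulE pcatp1 eqxx.
rewrite big1 ?addr0 // => v vp.
by rewrite pa_mulE pcatp1 eq_sym (negbTE vp).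
Qed.

HB.instance Definition _ := Lmodule_isKAlgebra.Build K path_alg
  pa_mulA pa_mul1 pa_mulr1 pa_mulDl pa_mulDr pa_scaleAl pa_scaleAr.
HB.instance Definition _ := GRing.PzRing.copy path_alg
  (path_alg : kAlgType K).

Definition arrow_elt (a : qarrow Q) : path_alg := path_elt (arrow_path a).

Definition arrow_ideal : ideal path_alg := ideal_gen (range arrow_elt).

Definition admissible (I : ideal path_alg) : Prop :=
  exists2 N, (2 <= N)%N &
    ideal_exp arrow_ideal N `<=` I /\ I `<=` ideal_exp arrow_ideal 2.

End PathAlgebra.

Section Occurrences.
Variables (V P : finType) (poly : P -> {mset V}%mset).

Definition occ (alpha : V) (U : P) : nat := poly U alpha.

(* The entries of the list of polygons containing alpha: each polygon U is
   listed occ alpha U times, the occurrences being told apart by an index. *)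
Definition occurrence (alpha : V) : finType := {U : P & 'I_(occ alpha U)}.

Definition valency (alpha : V) : nat := (\sum_(U : P) occ alpha U)%N.

End Occurrences.

(* A cyclic ordering of a finite set is given by its successor function, a
   permutation with a single cycle. *)
Record brauer_config := BrauerConfig {
  bvertex : finType;
  bpolygon : finType;
  polygon : bpolygon -> {mset bvertex}%mset;
  mult : bvertex -> nat;
  orient : forall alpha, {perm occurrence polygon alpha};
  mult_gt0 : forall alpha, (0 < mult alpha)%N;
  orient_cyclic : forall alpha (x y : occurrence polygon alpha),
    y \in porbit (orient alpha) x;
  vertex_covered : forall alpha, exists U, alpha \in polygon U;
  polygon_size : forall U, (2 <= size (polygon U))%N;
  polygon_nontruncated : forall U, exists2 alpha, alpha \in polygon U &
    (1 < valency polygon alpha * mult alpha)%N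
}.

Section BrauerConfigurationAlgebra.
Variables (K : fieldType) (G : brauer_config).

Definition bval (alpha : bvertex G) : nat := valency (@polygon G) alpha.

Definition truncated (alpha : bvertex G) : bool :=
  (bval alpha * mult alpha == 1)%N.

Definition ntvertex := {alpha : bvertex G | ~~ truncated alpha}.

Definition occ_at (alpha : ntvertex) : finType :=
  occurrence (@polygon G) (val alpha).

(* The arrow a_r at alpha is indexed by the r-th entry of the successor
   sequence at alpha. *)
Definition barrow : finType := {alpha : ntvertex & occ_at alpha}.

Definition next_arrow (a : barrow) : barrow :=
  Tagged occ_at (orient (val (tag a)) (tagged a)).

Definition barrow_src (a : barrow) : bpolygon G := tag (tagged a).

Definition brauer_quiver : quiver :=
  @Quiver (bpolygon G) barrow barrow_src (barrow_src \o next_arrow).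

Lemma walk_traject (a : barrow) n :
  @walk brauer_quiver (barrow_src a) (traject next_arrow a n).
Proof. by elim: n a => //= n IH a; rewrite eqxx IH. Qed.

(* C_j = a_j a_(j+1) ... a_(j-1), as a function of its first arrow a_j *)
Definition special_cycle (a : barrow) : qpath brauer_quiver :=
  mkpath (walk_traject a (bval (val (tag a)))).

Definition is_special_cycle (alpha : ntvertex) (v : bpolygon G)
    (C : qpath brauer_quiver) : Prop :=
  exists a : barrow, [/\ tag a = alpha, barrow_src a = v & C = special_cycle a].

Inductive brauer_relation : path_alg K brauer_quiver -> Prop :=
| TypeOne (v : bpolygon G) (alpha beta : ntvertex) C C' :
    is_special_cycle alpha v C -> is_special_cycle beta v C' ->
    brauer_relation
      (path_elt K C ^+ mult (val alpha) - path_elt K C' ^+ mult (val beta))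
| TypeTwo (v : bpolygon G) (alpha : ntvertex) C (a : barrow) s :
    is_special_cycle alpha v C -> parrows C = a :: s ->
    brauer_relation
      (path_elt K C ^+ mult (val alpha) * @arrow_elt K brauer_quiver a)
| TypeThree (p : qpath brauer_quiver) (a b : barrow) :
    parrows p = [:: a; b] ->
    ~ (exists v alpha C,
         is_special_cycle alpha v C /\ infix [:: a; b] (parrows C)) ->
    ~ (a = b /\ bval (val (tag a)) = 1%N /\ (1 < mult (val (tag a)))%N) ->
    brauer_relation (path_elt K p).

Definition brauer_ideal : ideal (path_alg K brauer_quiver) :=
  ideal_gen brauer_relation.

Definition brauer_algebra : kAlgType K := quot_alg brauer_ideal.

End BrauerConfigurationAlgebra.

(* Main.v *)
(* The linear form on the path algebra that sums the coefficients of the paths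
   C^mu(alpha), one for each special cycle C, is a trace, since rotating such a
   path gives another one, and it kills the relations. The trivial paths, the
   proper nontrivial subpaths of the C^mu(alpha), and one C^mu(alpha) for each
   polygon span the quotient; completing a path to a full C^mu(alpha) gives a
   family dual to them for the trace form. *)

Require Import Defs.
From HB Require Import structures.
From mathcomp Require Import all_boot all_algebra perm.
From mathcomp Require Import finmap multiset monalg classical_sets.

Set Implicit Arguments.
Unset Strict Implicit.
Unset Printing Implicit Defensive.

Import GRing.Theory.
Local Open Scope ring_scope.

(** * Symmetric algebras from dual bases for a trace form *)

Section MulForm.
Variables (K : fieldType) (A : kAlgType K) (phi : {scalar A}).

Definition mul_form (x z : A) : K := phi (x * z).

Fact mul_form_is_linear x : linear_for *%R (mul_form x).
Proof. by move=> c y z; rewrite /mul_form mulrDr -kscalerAr linearP. Qed.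

HB.instance Definition _ x :=
  GRing.isLinear.Build K A K *%R (mul_form x) (mul_form_is_linear x).

End MulForm.

Section DualBases.
Variables (K : fieldType) (A : kAlgType K) (phi : {scalar A}).
Variables (B : finType) (b bd : B -> A).
Hypothesis phiC : forall x y, phi (x * y) = phi (y * x).
Hypothesis phi_dual : forall i j, phi (bd i * b j) = (i == j)%:R.
Hypothesis b_span : forall x, exists c : B -> K, x = \sum_i c i *: b i.

Lemma dual_basis_coef (c : B -> K) i : phi (bd i * \sum_j c j *: b j) = c i.
Proof.
rewrite mulr_sumr linear_sum (bigD1 i) //= -kscalerAr linearZ phi_dual eqxx.
rewrite /= mulr1 big1 ?addr0 // => j ji.
by rewrite -kscalerAr linearZ phi_dual eq_sym (negbTE ji) /= mulr0.
Qed.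

(** Pairing with [bd i] reads off the [i]-th coefficient, so duality turns the spanning family [b]
    into a basis. *)
Lemma dual_basis_expansion x : x = \sum_i phi (bd i * x) *: b i.
Proof.
have [c ->] := b_span x; apply: eq_bigr => i _.
by rewrite dual_basis_coef.
Qed.

Lemma dual_basis_finite_dimensional : finite_dimensional A.
Proof.
exists #|B|; constructor.
exists (fun x => \row_k phi (bd (enum_val k) * x)) => [c x y|].
  by apply/rowP => k; rewrite !mxE mulrDr -kscalerAr linearP.
exists (fun u : 'rV_#|B| => \sum_i u ord0 (enum_rank i) *: b i) => [x|u].
  rewrite [RHS]dual_basis_expansion; apply: eq_bigr => i _.
  by rewrite mxE enum_rankK.
by apply/rowP => k; rewrite mxE dual_basis_coef enum_valK.
Qed.

Lemma dual_basis_symmetric : symmetric_algebra A.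
Proof.
split; first exact: dual_basis_finite_dimensional.
exists (mul_form phi); split=> [c x y z|a x c z|x y Exy|f]; rewrite /=.
- by rewrite /mul_form mulrDl -kscalerAl linearP.
- by rewrite /mul_form -!mulrA phiC !mulrA.
(* By the trace property, the coefficients of [x] are the values of [mul_form phi x] at the
   [bd i]. *)
- rewrite [x]dual_basis_expansion [y]dual_basis_expansion.
  by apply: eq_bigr => i _; rewrite phiC (phiC _ y); congr (_ *: _); apply: Exy.
(* Against [b j] this element pairs to [f (b j)], so it represents [f]. *)
exists (\sum_i f (b i) *: bd i) => z; rewrite /mul_form.
rewrite {2}[z]dual_basis_expansion mulr_suml !linear_sum.
by apply: eq_bigr => i _; rewrite -kscalerAl !linearZ /= mulrC.
Qed.

End DualBases.

(** * Ideals, and dual bases modulo an ideal *)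

Section IdealTheory.
Variables (K : fieldType) (A : kAlgType K).

Lemma ideal_gen_min (S J : set A) :
  two_sided_ideal J -> (S `<=` J)%classic -> (ideal_gen S `<=` J)%classic.
Proof. by move=> HJ SJ x; apply. Qed.

Lemma ideal_gen_sub (S : set A) : (S `<=` ideal_gen S)%classic.
Proof. by move=> x Sx I [_]; apply. Qed.

Variable I : ideal A.

Lemma ideal_scale (c : K) x : ideal_set I x -> ideal_set I (c *: x).
Proof.
have [_ _ IM] := idealP I => Ix.
by have := IM (c *: (1 : A)) x 1 Ix; rewrite mulr1 -kscalerAl mul1r.
Qed.

Lemma ideal_mull x y : ideal_set I y -> ideal_set I (x * y).
Proof. by have [_ _ IM] := idealP I => /(IM x _ 1); rewrite mulr1. Qed.

Lemma ideal_mulr x y : ideal_set I x -> ideal_set I (x * y).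
Proof. by have [_ _ IM] := idealP I => /(IM 1 _ y); rewrite mul1r. Qed.

Lemma ideal_sum (J : Type) (r : seq J) (P : pred J) (F : J -> A) :
  (forall j, P j -> ideal_set I (F j)) -> ideal_set I (\sum_(j <- r | P j) F j).
Proof. by have [I0 ID _] := idealP I => IF; apply: big_ind. Qed.

End IdealTheory.

Section QuotientDualBases.
Variables (K : fieldType) (A : kAlgType K) (I : ideal A) (phi : {scalar A}).

Local Notation pi := (quot_pi I).

Lemma quot_pi_is_linear : linear (pi : A -> quot_alg I).
Proof. by move=> c x y; rewrite quot_piD -quot_piZ. Qed.

Lemma quot_piMr x y : pi (x * y) = pi x * pi y :> quot_alg I.
Proof. by rewrite -quot_piM. Qed.

Hypothesis phiI : forall x, ideal_set I x -> phi x = 0.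

Definition quot_form (x : quot_alg I) : K := phi (repr x).

(** Two representatives differ by an element of [I], which [phi] kills. *)
Lemma quot_formE x : quot_form (pi x) = phi x.
Proof.
apply/eqP; rewrite -subr_eq0 -linearB; apply/eqP/phiI.
exact: quot_reprK.
Qed.

Fact quot_form_is_linear : linear_for *%R quot_form.
Proof.
move=> c x y; rewrite -(quot_piK x) -(quot_piK y) -quot_pi_is_linear.
by rewrite !quot_formE linearP.
Qed.

HB.instance Definition _ :=
  GRing.isLinear.Build K (quot_alg I) K *%R quot_form quot_form_is_linear.

Hypothesis phiC : forall x y, phi (x * y) = phi (y * x).
Variables (B : finType) (b bd : B -> A).
Hypothesis phi_dual : forall i j, phi (bd i * b j) = (i == j)%:R.
Hypothesis b_span :
  forall x, exists c : B -> K, ideal_set I (x - \sum_i c i *: b i).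

Lemma quot_dual_basis_symmetric : symmetric_algebra (quot_alg I).
Proof.
apply: (@dual_basis_symmetric K (quot_alg I) quot_form B (pi \o b) (pi \o bd)).
- move=> x y; rewrite -(quot_piK x) -(quot_piK y) -!quot_piMr.
  by rewrite /= !quot_formE.
- by move=> i j; rewrite /= -quot_piMr quot_formE.
move=> x; have [c Ic] := b_span (repr x); exists c.
have /quot_piP E := Ic; rewrite -[LHS]quot_piK E.
elim/big_rec2: _ => [|i u v _ <-]; last by rewrite quot_pi_is_linear.
(* The empty sum needs [pi 0 = 0], obtained by cancellation in [pi 0 + pi 0 = pi 0]. *)
by apply: (addrI (pi 0)); rewrite -quot_piD !addr0.
Qed.

End QuotientDualBases.

(** * Powers of the arrow ideal and path length *)

Section LengthFiltration.
Variables (K : fieldType) (Q : quiver).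
Implicit Types (p q r : qpath Q) (f g : path_alg K Q).

Lemma path_eltM p q :
  path_elt K p * path_elt K q = opath_elt K (pcat p q).
Proof. exact: pa_mulE. Qed.

Lemma path_elt_catE p q r :
    ptgt p = psrc q -> val r = (psrc p, parrows p ++ parrows q) ->
  path_elt K p * path_elt K q = path_elt K r.
Proof.
move=> /pcatP[r' Er' vr'] vr; rewrite path_eltM Er' /=.
by congr path_elt; apply: val_inj; rewrite vr' vr.
Qed.

Lemma path_elt_cons p a s : parrows p = a :: s ->
  exists q, [/\ psrc q = qtgt a, parrows q = s
              & path_elt K p = arrow_elt K a * path_elt K q].
Proof.
case: p => -[v t] w; rewrite /parrows /= => Et; subst t.
have /= /andP[/eqP va ws] := w; exists (mkpath ws); split=> //.
by apply/esym/path_elt_catE; rewrite //= -va.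
Qed.

(** The [n]-th power of the arrow ideal in terms of coefficients; the lemmas below give both
    inclusions. *)
Definition length_ge (n : nat) : set (path_alg K Q) :=
  [set f | forall p, (size (parrows p) < n)%N -> f@_p = 0]%classic.

Lemma length_geD n f g : length_ge n f -> length_ge n g -> length_ge n (f + g).
Proof. by move=> Hf Hg p Hp; rewrite mcoeffD Hf ?Hg ?addr0. Qed.

Lemma length_ge0 n : length_ge n 0.
Proof. by move=> p _; rewrite mcoeff0. Qed.

Lemma length_geZ n c f : length_ge n f -> length_ge n (c *: f).
Proof. by move=> Hf p Hp; rewrite mcoeff_scale Hf ?mulr0. Qed.

Lemma length_ge_path n p :
  (n <= size (parrows p))%N -> length_ge n (path_elt K p).
Proof.
move=> np q qn; rewrite mcoeff_path_elt; case: eqP => // E.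
by move: qn; rewrite -E ltnNge np.
Qed.

Lemma length_ge_msupp n f p :
  length_ge n f -> p \in msupp f -> (n <= size (parrows p))%N.
Proof.
move=> Hf; rewrite leqNgt -mcoeff_neq0; apply: contraNN => Hp.
by rewrite Hf.
Qed.

Lemma length_geM m n f g :
  length_ge m f -> length_ge n g -> length_ge (m + n) (f * g).
Proof.
move=> Hf Hg; rewrite [f]path_algE [g]path_algE mulr_suml big_seq.
apply: big_ind => [||p /(length_ge_msupp Hf) mp].
- exact: length_ge0.
- exact: length_geD.
rewrite mulr_sumr big_seq.
apply: big_ind => [||q /(length_ge_msupp Hg) nq].
- exact: length_ge0.
- exact: length_geD.
rewrite -kscalerAl -kscalerAr path_eltM; do 2!apply: length_geZ.
have [E|N] := eqVneq (ptgt p) (psrc q); last first.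
  by rewrite pcatN //; apply: length_ge0.
have [r -> vr] := pcatP E; apply: length_ge_path.
by rewrite {1}/parrows vr /= size_cat leq_add.
Qed.

Lemma length_ge_ideal n : two_sided_ideal (length_ge n).
Proof.
split; [exact: length_ge0|by move=> f g; apply: length_geD|].
(* The degree [n] is split as [0 + n + 0], the outer factors being arbitrary. *)
move=> f g h Hg; have H0 k : length_ge 0 k by [].
by rewrite -[n]addn0 -[n]add0n; do 2!apply: length_geM => //.
Qed.

Lemma arrow_ideal_exp_length_ge n :
  (ideal_exp (arrow_ideal K Q) n `<=` length_ge n)%classic.
Proof.
elim: n => [//|n IH]; apply: ideal_gen_min; first exact: length_ge_ideal.
move=> _ [x Jx [y Jy <-]]; rewrite -add1n; apply: length_geM; last exact: IH.
move: Jx; apply: ideal_gen_min; first exact: length_ge_ideal.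
by move=> _ [a _ <-]; apply: length_ge_path.
Qed.

Lemma path_arrow_ideal_exp n p :
  (n <= size (parrows p))%N ->
  ideal_set (ideal_exp (arrow_ideal K Q) n) (path_elt K p).
Proof.
elim: n p => [|n IH] p; first by move=> _; apply: ideal_gen_sub.
case Ep: (parrows p) => [//|a s]; rewrite ltnS => ns.
have [q [_ Eq ->]] := path_elt_cons Ep.
apply: ideal_gen_sub; exists (arrow_elt K a).
  by apply: ideal_gen_sub; exists a.
by exists (path_elt K q) => //; apply: IH; rewrite Eq.
Qed.

Lemma length_ge_sub n (I : ideal (path_alg K Q)) :
  (forall p, (n <= size (parrows p))%N -> ideal_set I (path_elt K p)) ->
  (length_ge n `<=` I)%classic.
Proof.
move=> Ip f Hf; rewrite [f]path_algE big_seq; apply: ideal_sum => p.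
by move=> /(length_ge_msupp Hf) np; apply: ideal_scale; apply: Ip.
Qed.

End LengthFiltration.

(** * Runs of successive arrows and full words *)

Lemma infix_traject (T : eqType) (f : T -> T) x y z n :
  infix [:: x; y] (traject f z n) -> y = f x.
Proof.
case/infixP=> s1 [s2]; elim: s1 n z => [|w s1 IH] [|n] z //=.
  by case: n => //= n [-> <-].
by case=> _ /IH.
Qed.

Section Runs.
Variable G : brauer_config.
Local Notation nx := (@next_arrow G).
Local Notation Q := (brauer_quiver G).
Implicit Types (a b : barrow G) (s : seq (barrow G)).

Lemma card_occurrence (alpha : bvertex G) :
  #|occurrence (@polygon G) alpha| = bval alpha.
Proof.
rewrite card_tagged sumnE big_map big_enum.
by apply: eq_bigr => U _; rewrite card_ord.
Qed.

Lemma iter_next_arrow n a :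
  iter n nx a = Tagged (@occ_at G) (iter n (orient (val (tag a))) (tagged a)).
Proof. by elim: n => [|n IH] /=; [case: a|rewrite IH]. Qed.

Lemma tag_iter_next n a : tag (iter n nx a) = tag a.
Proof. by rewrite iter_next_arrow. Qed.

Definition cycle_length a : nat := bval (val (tag a)).
(** The length of [C^mu(alpha)], where [C] is the special [alpha]-cycle with first arrow [a]. *)
Definition full_length a : nat := (cycle_length a * mult (val (tag a)))%N.

(** The orientation has a single cycle, so the orbit of [tagged a] consists of all [bval]
    occurrences. *)
Lemma iter_cycle_length a : iter (cycle_length a) nx a = a.
Proof.
rewrite iter_next_arrow.
have -> : cycle_length a = #|porbit (orient (val (tag a))) (tagged a)|.
  rewrite /cycle_length -card_occurrence; apply: eq_card => x.
  by rewrite orient_cyclic.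
by rewrite iter_porbit; case: a.
Qed.

Lemma iter_mul_cycle_length k a : iter (k * cycle_length a) nx a = a.
Proof. by elim: k => //= k IH; rewrite mulSn iterD IH iter_cycle_length. Qed.

Lemma iter_full_length a : iter (full_length a) nx a = a.
Proof. by rewrite /full_length mulnC iter_mul_cycle_length. Qed.

Lemma cycle_length_gt0 a : (0 < cycle_length a)%N.
Proof.
rewrite /cycle_length -card_occurrence.
by apply/card_gt0P; exists (tagged a).
Qed.

(** Being nontruncated excludes the value 1, and positivity of both factors excludes 0. *)
Lemma full_length_gt1 a : (1 < full_length a)%N.
Proof.
have := valP (tag a); rewrite /truncated -/(cycle_length a) -/(full_length a).
have : (0 < full_length a)%N by rewrite muln_gt0 cycle_length_gt0 mult_gt0.
by case: full_length => [|[|]].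
Qed.

Lemma full_length_gt0 a : (0 < full_length a)%N.
Proof. exact/ltnW/full_length_gt1. Qed.

Lemma full_length_iter n a : full_length (iter n nx a) = full_length a.
Proof. by rewrite /full_length /cycle_length tag_iter_next. Qed.

(** Arrows with equal successors sit at the same vertex, so they return to themselves after the same
    positive number of steps, the first of which merges them. *)
Lemma next_arrow_inj : injective nx.
Proof.
move=> a b E; have tE : tag a = tag b := congr1 tag E.
rewrite -(iter_cycle_length a) -(iter_cycle_length b) /cycle_length tE.
have := cycle_length_gt0 b; rewrite /cycle_length; case: bval => // n _.
by rewrite !iterSr E.
Qed.

Lemma iter_next_inj n : injective (iter n nx).
Proof. by elim: n => [|n IH] a b; [exact: id|move=> /next_arrow_inj/IH]. Qed.

(** The length [n] is unrestricted, so runs include the trivial paths [run a 0] and all powers of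
    special cycles. *)
Definition run a n : qpath Q := mkpath (walk_traject a n).

Lemma ptgt_run a n : ptgt (run a n) = barrow_src (iter n nx a).
Proof.
rewrite /ptgt /psrc /parrows /=.
by elim: n a => //= n IH a; rewrite IH -iterSr.
Qed.

Lemma fpath_run (p : qpath Q) a s :
  parrows p = a :: s -> fpath nx a s -> p = run a (size s).+1.
Proof.
case: p => -[v t] w; rewrite /parrows /= => E; subst t => sf.
apply: val_inj; rewrite /=; have /= /andP[/eqP <- _] := w.
by have /fpathP[m ->] := sf; rewrite size_traject.
Qed.

(** The arrow words of the paths [C^mu(alpha)]. Working with words allows a concatenation to be
    tested before it is known to be a path; the value at the empty word is right because full
    lengths are positive. *)
Definition full s : bool :=
  if s is a :: _ then s == traject nx a (full_length a) else false.

Lemma fullP s : reflect (exists c, s = traject nx c (full_length c)) (full s).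
Proof.
case: s => [|a s] /=.
  by constructor => -[c]; case: full_length (full_length_gt0 c).
apply: (iffP eqP) => [->|[c]]; first by exists a.
by case E: full_length (full_length_gt0 c) => [//|n] _ [-> ->]; rewrite E.
Qed.

Lemma full_catP s1 s2 :
  reflect (exists c, [/\ full_length c = (size s1 + size s2)%N,
                         s1 = traject nx c (size s1)
                       & s2 = traject nx (iter (size s1) nx c) (size s2)])
          (full (s1 ++ s2)).
Proof.
apply: (iffP (fullP _)) => -[c]; last first.
  by case=> Ec E1 E2; exists c; rewrite Ec trajectD -E1 -E2.
move=> E; have Es := congr1 size E; rewrite size_cat size_traject in Es.
move/eqP: E; rewrite -Es trajectD eqseq_cat ?size_traject // => E.
exists c; split=> //; move: E.
  by case/andP => /eqP.
by case/andP => _ /eqP.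
Qed.

(** A rotated full word is the full word starting at the cut. This is the source of the trace
    property. *)
Lemma full_catC s1 s2 : full (s1 ++ s2) = full (s2 ++ s1).
Proof.
suff H t1 t2 : full (t1 ++ t2) -> full (t2 ++ t1) by apply/idP/idP; apply: H.
case/full_catP=> c [Ec E1 E2]; apply/full_catP; exists (iter (size t1) nx c).
by rewrite full_length_iter -iterD addnC -Ec iter_full_length.
Qed.

(** A full word closes up cyclically, so the prefix is forced: it starts where the run from [a]
    stops and has the missing length, possibly 0. *)
Lemma full_cat_traject s a n :
  full (s ++ traject nx a n.+1) =
  (n < full_length a)%N &&
    (s == traject nx (iter n.+1 nx a) (full_length a - n.+1)).
Proof.
apply/full_catP/andP => [[c]|[na /eqP->]]; rewrite !size_traject.
  move=> [Ec Es [Ea _]]; rewrite Ea full_length_iter {1}Ec addnS ltnS leq_addl.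
  by rewrite -iterD addnC -Ec iter_full_length Ec addnK {1}Es.
exists (iter n.+1 nx a); rewrite full_length_iter -iterD subnK //.
by rewrite iter_full_length.
Qed.

Lemma full_cat_pair s a b : full (s ++ [:: a; b]) -> b = nx a.
Proof. by move=> /full_catP[c [_ _ [-> ->]]]. Qed.

Lemma eq_run (p : qpath Q) a n :
  (0 < n)%N -> parrows p = traject nx a n -> p = run a n.
Proof.
case: n => // n _ E; rewrite (fpath_run E) ?size_traject //.
exact: fpath_traject.
Qed.

Lemma full_catr_full (s : seq (barrow G)) a :
  full (s ++ traject nx a (full_length a)) = (s == [::]).
Proof.
case E: (full_length a) (full_length_gt0 a) => [//|n] _.
by rewrite full_cat_traject E ltnSn subnn.
Qed.

Lemma full_short a n :
  (0 < n < full_length a)%N -> full (traject nx a n) = false.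
Proof.
case: n => // n /andP[_ na].
rewrite -[traject _ _ _]cat0s full_cat_traject eq_sym -size_eq0 size_traject.
by rewrite subn_eq0 [(_ <= n.+1)%N]leqNgt na andbF.
Qed.

Lemma full_catl_full a (s : seq (barrow G)) :
  full (traject nx a (full_length a) ++ s) = (s == [::]).
Proof. by rewrite full_catC full_catr_full. Qed.

Lemma full_traject_full a : full (traject nx a (full_length a)).
Proof. by apply/fullP; exists a. Qed.

(** The complement determines the run: its first arrow fixes the vertex and thus the full length,
    its length then gives [n], and going back [n] steps gives [a]. *)
Lemma full_complement a b n m : (0 < n < full_length a)%N ->
  full (traject nx (iter n nx a) (full_length a - n) ++ traject nx b m.+1) =
  (m.+1 == n) && (a == b).
Proof.
case/andP=> n0 na; rewrite full_cat_traject.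
apply/andP/andP=> [[mb /eqP E]|[/eqP-> /eqP <-]]; last first.
  by rewrite eqxx ltnW.
have := congr1 size E; rewrite !size_traject => Es; move: E; rewrite -Es.
have : (0 < full_length a - n)%N by rewrite subn_gt0.
case Ek: (_ - n)%N => [|k] // _ /= [Eab _]; have := congr1 full_length Eab.
rewrite -!iterS !full_length_iter => EL.
have nm : n = m.+1.
  by rewrite -[LHS](subKn (ltnW na)) Es EL subKn.
by move: Eab; rewrite nm => /iter_next_inj->.
Qed.

End Runs.

#[local] Arguments full : simpl never.

(** * The trace form and the Brauer relations *)

Section TraceForm.
Variables (K : fieldType) (G : brauer_config).
Local Notation nx := (@next_arrow G).
Local Notation Q := (brauer_quiver G).
Local Notation KQ := (path_alg K Q).
Local Notation elt := (@path_elt K Q).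
Local Notation I := (brauer_ideal K G).
Implicit Types (a b : barrow G) (p q : qpath Q).

Definition trace_form (f : KQ) : K :=
  \sum_(a : barrow G) f@_(run a (full_length a)).

Fact trace_form_is_linear : linear_for *%R trace_form.
Proof.
move=> c f g; rewrite /trace_form mulr_sumr -big_split /=.
by apply: eq_bigr => a _; rewrite mcoeffD mcoeff_scale.
Qed.

HB.instance Definition _ :=
  GRing.isLinear.Build K KQ K *%R trace_form trace_form_is_linear.

Lemma trace_form_path p : trace_form (elt p) = (full (parrows p))%:R.
Proof.
rewrite /trace_form; under eq_bigr do rewrite mcoeff_path_elt.
have [/fullP[c Ec]|Nfull] := boolP (full _); last first.
  rewrite big1 // => a _; case: eqP => // E; case/negP: Nfull; apply/fullP.
  by exists a; rewrite E.
have Ep := eq_run (full_length_gt0 c) Ec.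
(* Only the summand at [c] survives: a full run is nonempty and determined by its first arrow. *)
rewrite (bigD1 c) //= {1}Ep eqxx big1 ?addr0 // => a ac.
case: eqP => // E; case/eqP: ac; move: Ec; rewrite E /parrows /=.
case: full_length (full_length_gt0 a) => // m _.
by case: full_length (full_length_gt0 c) => // n _ [].
Qed.

Lemma trace_form_pathM p q :
  trace_form (elt p * elt q) =
  ((ptgt p == psrc q) && full (parrows p ++ parrows q))%:R.
Proof.
rewrite path_eltM; have [E|N] := eqVneq (ptgt p) (psrc q); last first.
  by rewrite pcatN // linear0.
have [r -> vr] := pcatP E.
by rewrite trace_form_path {1}/parrows vr.
Qed.

(** A full path returns to its source, so factors that compose in one order compose in the other. *)
Lemma full_closed p q :
  ptgt p = psrc q -> full (parrows p ++ parrows q) -> ptgt q = psrc p.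
Proof.
move=> E; have [r _ vr] := pcatP E.
have -> : parrows p ++ parrows q = parrows r by rewrite {3}/parrows vr.
case/fullP=> c /(eq_run (full_length_gt0 c)) Er.
have -> : psrc p = psrc r by rewrite [RHS]/psrc vr.
have -> : ptgt q = ptgt r.
  by rewrite [RHS]/ptgt /psrc /parrows vr /= map_cat last_cat -/(ptgt p) E.
by rewrite Er ptgt_run iter_full_length.
Qed.

Lemma trace_formC f g : trace_form (f * g) = trace_form (g * f).
Proof.
elim/path_alg_ind: f => [|f1 f2 E1 E2|c p]; first by rewrite mul0r mulr0.
  by rewrite mulrDl mulrDr !linearD /= E1 E2.
elim/path_alg_ind: g => [|g1 g2 E1 E2|d q]; first by rewrite mul0r mulr0.
  by rewrite mulrDl mulrDr !linearD /= E1 E2.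
rewrite -!kscalerAl -!kscalerAr !linearZ /= mulrCA; do 2!congr (_ * _).
rewrite !trace_form_pathM; congr (_%:R); congr nat_of_bool.
by apply/andP/andP=> -[/eqP E F]; rewrite (full_closed E F) eqxx full_catC.
Qed.

Lemma path_elt_runM a m n :
  elt (run a m) * elt (run (iter m nx a) n) = elt (run a (m + n)).
Proof. by apply: path_elt_catE; rewrite ?ptgt_run // /parrows /= trajectD. Qed.

Lemma special_cycleX a :
  elt (special_cycle a) ^+ mult (val (tag a)) = elt (run a (full_length a)).
Proof.
rewrite /full_length mulnC; case: mult (mult_gt0 (val (tag a))) => // n _.
elim: n => [|n IH]; first by rewrite expr1 mul1n.
by rewrite exprSr IH [in RHS]mulSnr -path_elt_runM iter_mul_cycle_length.
Qed.

Lemma special_cycle_at a :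
  is_special_cycle (tag a) (barrow_src a) (special_cycle a).
Proof. by exists a. Qed.

Lemma run_sub_run a b : barrow_src a = barrow_src b ->
  ideal_set I (elt (run a (full_length a)) - elt (run b (full_length b))).
Proof.
move=> ab; rewrite -!special_cycleX; apply: ideal_gen_sub.
apply: (TypeOne K (v := barrow_src a)); last rewrite ab;
  exact: special_cycle_at.
Qed.

Lemma parrows_special_cycle a : exists s, parrows (special_cycle a) = a :: s.
Proof.
rewrite /parrows /= -/(cycle_length a).
by case: cycle_length (cycle_length_gt0 a) => // n _; eexists.
Qed.

Lemma type_two_run a :
  elt (special_cycle a) ^+ mult (val (tag a)) * arrow_elt K (a : qarrow Q) =
  elt (run a (full_length a).+1).
Proof.
rewrite special_cycleX -addn1 -path_elt_runM iter_full_length.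
by congr (_ * elt _); apply: val_inj.
Qed.

(** The first [full_length a + 1] arrows already form a type two relation. *)
Lemma long_run a n : (full_length a < n)%N -> ideal_set I (elt (run a n)).
Proof.
move=> Ln; rewrite -(subnKC Ln) -path_elt_runM; apply: ideal_mulr.
rewrite -type_two_run; apply: ideal_gen_sub.
have [s Es] := parrows_special_cycle a.
exact: TypeTwo (special_cycle_at a) Es.
Qed.

(** If [b] succeeds [a], either the cycle has at least two arrows and begins with [ab], or [a = b]
    is a loop whose multiplicity exceeds 1 because its vertex is nontruncated. *)
Lemma type_three_neq a b :
  ~ (exists v alpha C,
       is_special_cycle alpha v C /\ infix [:: a; b] (parrows C)) ->
  ~ (a = b /\ bval (val (tag a)) = 1%N /\ (1 < mult (val (tag a)))%N) ->
  b <> nx a.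
Proof.
move=> Ncyc Nloop Eb; have := full_length_gt1 a; rewrite /full_length.
case: (ltngtP (cycle_length a) 1%N) => [|cl|cl].
- by rewrite ltnNge cycle_length_gt0.
- case: Ncyc; exists (barrow_src a), (tag a), (special_cycle a).
  split; first exact: special_cycle_at.
  rewrite /parrows /= -/(cycle_length a) Eb.
  case: cycle_length cl => [|[|n]] // _.
  by apply: prefixW; rewrite /= !eqxx prefix0s.
rewrite cl mul1n => m1; apply: Nloop; split=> //.
by rewrite Eb -[nx a]/(iter 1 nx a) -cl iter_cycle_length.
Qed.

(** Special cycles contain only successive pairs, and the excepted loop is its own successor, so [p]
    is a type three relation. *)
Lemma non_next_pair p a b :
  parrows p = [:: a; b] -> b <> nx a -> ideal_set I (elt p).
Proof.
move=> Ep Nab; apply: ideal_gen_sub; apply: (TypeThree K Ep).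
  case=> v [alpha [C [[c [_ _ ->]]]]]; rewrite /parrows /=.
  by move/infix_traject.
case=> Eab [v1 _]; apply: Nab; rewrite -Eab.
by rewrite -[nx a]/(iter 1 nx a) -v1 iter_cycle_length.
Qed.

(** The first pair of arrows that are not successive splits off as a factor lying in [I]. *)
Lemma non_fpath p a s :
  parrows p = a :: s -> ~~ fpath nx a s -> ideal_set I (elt p).
Proof.
elim: s p a => [//|b s IH] p a Ep Ns.
have [q [sq Eq ->]] := path_elt_cons K Ep.
have [Eb|Nab] := eqVneq b (nx a).
  by apply: ideal_mull; apply: IH Eq _; move: Ns; rewrite /= -Eb eqxx.
have [r [sr _ ->]] := path_elt_cons K Eq.
have sb : barrow_src b = barrow_src (nx a).
  by have := valP q; rewrite -/(parrows q) Eq /= => /andP[/eqP-> _].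
have wab : @walk Q (barrow_src a) [:: a; b] by rewrite /= sb !eqxx.
have Eab : arrow_elt K (a : qarrow Q) * arrow_elt K (b : qarrow Q) =
  elt (mkpath wab) by apply: path_elt_catE; rewrite //= /ptgt /=.
rewrite mulrA Eab; apply: ideal_mulr; apply: (@non_next_pair _ a b) => //.
exact/eqP.
Qed.

Lemma trace_form_ideal x : ideal_set I x -> trace_form x = 0.
Proof.
move=> Ix; rewrite -[x]mul1r; move: (1 : KQ) => y; move: x Ix y.
(* Allowing a left factor [y] makes the vanishing condition a two-sided ideal: right factors are
   moved to the left by the trace property. *)
suff: (I `<=` [set x | forall y, trace_form (y * x) = 0])%classic by [].
apply: ideal_gen_min.
  split=> [y|f g Hf Hg y|f x g Hx y]; first by rewrite mulr0 linear0.
    by rewrite mulrDr linearD /= Hf Hg addr0.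
  by rewrite mulrA trace_formC !mulrA; apply: Hx.
move=> x Rx y; elim/path_alg_ind: y => [|f g Ef Eg|c p].
- by rewrite mul0r linear0.
- by rewrite mulrDl linearD /= Ef Eg addr0.
rewrite -kscalerAl linearZ /=; apply/eqP; rewrite mulf_eq0; apply/orP; right.
apply/eqP; case: Rx => [v alpha beta C C' [a [<- sa ->]] [b [<- sb ->]]|
  v alpha C a s [b [<- sa ->]]|q a b Eq Ncyc Nloop].
(* A word ending in a full word is full only if nothing precedes it; both terms start at [v], so
   their traces agree. *)
- rewrite !special_cycleX mulrBr linearB /= !trace_form_pathM /psrc /=.
  by rewrite sa sb !full_catr_full subrr.
(* A word ending in a run one arrow longer than the full length is never full. *)
- have [t Et] := parrows_special_cycle b; rewrite Et => -[Eb _]; subst b.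
  rewrite type_two_run trace_form_pathM full_cat_traject ltnn /=.
  by rewrite andbF.
rewrite trace_form_pathM Eq; case: andP => // -[_ /full_cat_pair Eb].
by case: (type_three_neq Ncyc Nloop).
Qed.

End TraceForm.

(** * Dual bases modulo the Brauer relations, and admissibility *)

Section BrauerDualBases.
Variables (K : fieldType) (G : brauer_config).
Local Notation nx := (@next_arrow G).
Local Notation Q := (brauer_quiver G).
Local Notation KQ := (path_alg K Q).
Local Notation elt := (@path_elt K Q).
Local Notation I := (brauer_ideal K G).
Implicit Types (a b : barrow G) (v w : bpolygon G) (p q : qpath Q).

(** Every polygon contains a nontruncated vertex; its occurrence numbered 0 indexes an arrow from
    [v]. *)
Lemma barrow_exists v : exists a, barrow_src a == v.
Proof.
have [alpha av nt] := @polygon_nontruncated G v.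
have nta : ~~ truncated alpha by rewrite /truncated neq_ltn nt orbT.
have o : (0 < occ (@polygon G) alpha v)%N by rewrite /occ -in_mset.
by exists (Tagged (@occ_at G) (i := exist _ alpha nta) (Tagged _ (Ordinal o))).
Qed.

(** Fixes the full run that represents the socle element at [v]; by the type one relations, its
    class modulo [I] does not depend on the choice. *)
Definition arrow_from v : barrow G := xchoose (barrow_exists v).

Lemma arrow_from_src v : barrow_src (arrow_from v) = v.
Proof. exact/eqP/(xchooseP (barrow_exists v)). Qed.

Definition full_run a : qpath Q := run a (full_length a).

(* Indices of the trivial paths, of the socle elements, and of the paths
   [run a i.+1] strictly in between. *)
Definition basis_index : finType :=
  (bpolygon G + bpolygon G + {a : barrow G & 'I_(full_length a).-1})%type.

Definition basis_path (j : basis_index) : qpath Q :=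
  match j with
  | inl (inl v) => trivial_path (v : qvertex Q)
  | inl (inr v) => full_run (arrow_from v)
  | inr (existT a i) => run a i.+1
  end.

(** The completing factor stands on the left; trivial paths and socle elements complete each
    other. *)
Definition dual_path (j : basis_index) : qpath Q :=
  match j with
  | inl (inl v) => full_run (arrow_from v)
  | inl (inr v) => trivial_path (v : qvertex Q)
  | inr (existT a i) => run (iter i.+1 nx a) (full_length a - i.+1)
  end.

Lemma basis_index_lt a (i : 'I_(full_length a).-1) : (i.+1 < full_length a)%N.
Proof. by rewrite -ltn_predRL. Qed.

Lemma traject_nil a n : (0 < n)%N -> (traject nx a n == [::]) = false.
Proof. by case: n. Qed.

(** Off the diagonal the factors do not compose, or the word is empty, too short or too long to be
    full; pairs of intermediate runs are settled by [full_complement]. *)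
Lemma dual_basis_path i j :
  trace_form (elt (dual_path i) * elt (basis_path j)) = (i == j)%:R.
Proof.
rewrite trace_form_pathM; congr (_%:R); congr nat_of_bool.
case: i j => [[v|v]|[a i]] [[w|w]|[b j]]; rewrite /psrc /parrows ?ptgt_run /=.
- by rewrite cats0 full_traject_full iter_full_length arrow_from_src andbT.
- by rewrite full_catl_full traject_nil ?andbF ?full_length_gt0.
- by rewrite full_catl_full andbF.
- by rewrite andbF.
- by rewrite full_traject_full arrow_from_src andbT.
- by rewrite -[b :: _]/(traject nx b j.+1) full_short ?andbF // basis_index_lt.
- rewrite cats0 -iterS full_short ?andbF // full_length_iter subn_gt0.
  by rewrite basis_index_lt ltn_subrL full_length_gt0.
- rewrite full_catr_full traject_nil ?andbF // subn_gt0; exact: basis_index_lt.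
rewrite -[b :: _]/(traject nx b j.+1) full_complement ?basis_index_lt //.
apply/and3P/eqP => [[_ /eqP ji /eqP ab]|[ab]].
  by subst b; congr (inr (existT _ _ _)); apply: val_inj; case: ji.
subst b => /eqP; rewrite eq_Tagged => /eqP <-.
by rewrite -iterS -iterD subnK ?iter_full_length ?eqxx // ltnW ?basis_index_lt.
Qed.

(** A nontrivial path outside [I] is a run. Runs shorter than the full length are basis paths,
    longer ones lie in [I], and those of full length reduce to the chosen one by a type one
    relation. *)
Lemma path_basis p :
  ideal_set I (elt p) \/ exists j, ideal_set I (elt p - elt (basis_path j)).
Proof.
have I0 : ideal_set I 0 by have [] := idealP I.
case Ep: (parrows p) => [|a s].
  right; exists (inl (inl (psrc p))).
  rewrite /= (_ : trivial_path _ = p) ?subrr //.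
  by apply: val_inj; rewrite [RHS]surjective_pairing -/(parrows p) Ep.
have [sf|Nsf] := boolP (fpath nx a s); last by left; apply: non_fpath Ep Nsf.
rewrite (fpath_run Ep sf).
case: (ltngtP (size s).+1 (full_length a)) => [sL|sL|->].
- have i : (size s < (full_length a).-1)%N by rewrite ltn_predRL.
  right; exists (inr (Tagged (fun b => 'I_(full_length b).-1) (Ordinal i))).
  by rewrite subrr.
- by left; apply: long_run.
right; exists (inl (inr (barrow_src a))); apply: run_sub_run.
by rewrite arrow_from_src.
Qed.

Lemma path_alg_basis (x : KQ) :
  exists c : basis_index -> K,
    ideal_set I (x - \sum_j c j *: elt (basis_path j)).
Proof.
have [I0 ID _] := idealP I.
elim/path_alg_ind: x => [|f g [c Ic] [d Id]|c p].
- exists (fun=> 0); rewrite big1 ?subrr // => j _; exact: scale0r.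
- exists (fun j => c j + d j).
  under eq_bigr do rewrite scalerDl.
  by rewrite big_split /= opprD addrACA; apply: ID.
have [Ip|[j Ij]] := path_basis p.
  exists (fun=> 0); rewrite big1 ?subr0; first exact: ideal_scale.
  by move=> j _; exact: scale0r.
exists (fun i => if i == j then c else 0).
rewrite (bigD1 j) //= eqxx big1 ?addr0 => [|i /negbTE->]; last exact: scale0r.
by rewrite -scalerBr; exact: (ideal_scale c Ij).
Qed.

Lemma brauer_ideal_admissible : admissible I.
Proof.
(* Runs longer than every full length lie in [I]; adding 2 also secures [2 <= N] when there are no
   arrows. *)
exists (\max_(a : barrow G) full_length a).+2 => //; split.
  apply: subset_trans (@arrow_ideal_exp_length_ge K Q _) _.
  apply: length_ge_sub => p; case Ep: (parrows p) => [//|a s] Hs.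
  have [sf|Nsf] := boolP (fpath nx a s); last exact: non_fpath Ep Nsf.
  rewrite (fpath_run Ep sf); apply: long_run.
  by apply: leq_ltn_trans Hs; rewrite (leq_trans (leq_bigmax a)).
(* It remains to see that the generators involve only paths of length at least 2, which holds
   because full lengths exceed 1. *)
apply: subset_trans _ (length_ge_sub (@path_arrow_ideal_exp K Q 2)).
apply: ideal_gen_min; first exact: length_ge_ideal.
have run_ge2 a n : (1 < n)%N -> length_ge 2 (elt (run a n)).
  by move=> n2; apply: length_ge_path; rewrite /parrows /= size_traject.
move=> _ [v alpha beta C C' [a [<- _ ->]] [b [<- _ ->]]|
  v alpha C a s [b [<- _ ->]]|p a b Ep _ _].
- rewrite !special_cycleX.
  apply: length_geD; first exact/run_ge2/full_length_gt1.
  rewrite -scaleN1r; apply: length_geZ; exact/run_ge2/full_length_gt1.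
- have [t ->] := parrows_special_cycle b; case=> -> _.
  by rewrite type_two_run; apply/run_ge2; rewrite ltnS full_length_gt0.
by apply: length_ge_path; rewrite Ep.
Qed.

End BrauerDualBases.

Theorem proposition3p2 (K : fieldType) (G : brauer_config) :
  admissible (brauer_ideal K G) /\ symmetric_algebra (brauer_algebra K G).
Proof.
split; first exact: brauer_ideal_admissible.
exact: (quot_dual_basis_symmetric (@trace_form_ideal K G) (@trace_formC K G)
  (@dual_basis_path K G) (@path_alg_basis K G)).
Qed.
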